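(* Let $n$ be a positive integer and suppose given (1) points $\alpha_1,\ldots,\alpha_{k_0}\in\mathbb D$ and $\tau_1,\ldots,\tau_{k_1}\in\mathbb T$, where $2k_0+k_1=n$; (2) points $\sigma_1,\ldots,\sigma_n\in\overline{\mathbb D}$ distinct from $\tau_1,\ldots,\tau_{k_1}$ (that is, $\sigma_i\neq\tau_j$ for all $i,j$). Then there exists a rational $\Gamma$-inner function $h=(s,p)$ of degree $n$ such that the zeros of $s$ in $\overline{\mathbb D}$, repeated according to multiplicity, are $\alpha_1,\ldots,\alpha_{k_0},\tau_1,\ldots,\tau_{k_1}$ and the royal nodes of $h$, repeated according to multiplicity, are $\sigma_1,\ldots,\sigma_n$.
   Context: $\mathbb D$ is the open unit disc in $\mathbb C$ and $\mathbb T$ the unit circle. $\mathcal G=\{(z+w,zw):z,w\in\mathbb D\}\subset\mathbb C^2$, $\Gamma=\overline{\mathcal G}$, and $b\Gamma$ is the distinguished boundary of $\Gamma$, i.e. the smallest closed subset of $\Gamma$ on which every continuous function on $\Gamma$ that is analytic in $\mathcal G$ attains its maximum modulus; explicitly $b\Gamma=\{(s,p)\in\mathbb C^2:|s|\le2,\ |p|=1,\ s=\overline s p\}$. A rational $\Gamma$-inner function is a rational analytic map $h=(s,p):\mathbb D\to\Gamma$ whose (continuous) extension to $\overline{\mathbb D}$ maps $\mathbb T$ into $b\Gamma$. Its degree $\deg(h)$ is the nonnegative integer $|h_*(1)|$, where $h_*:\mathbb Z=\pi_1(\mathbb T)\to\pi_1(b\Gamma)\cong\mathbb Z$ is induced by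 $h|_{\mathbb T}:\mathbb T\to b\Gamma$; it equals the degree of the finite Blaschke product $p$. The royal variety is $\mathcal R=\{(2z,z^2):z\in\mathbb C\}$. A royal node of $h$ is a point $\lambda\in\overline{\mathbb D}$ with $h(\lambda)\in\mathcal R$. For a polynomial $f$ of degree at most $n$ put $f^{\sim n}(\lambda)=\lambda^n\overline{f(1/\overline\lambda)}$. If $h=(s,p)$ is rational $\Gamma$-inner of degree $n$, there are polynomials $E,D$ of degree at most $n$, unique up to a common nonzero real factor, with $E^{\sim n}=E$, $D\ne0$ on $\overline{\mathbb D}$, $|E|\le2|D|$ on $\overline{\mathbb D}$, $s=E/D$ and $p=D^{\sim n}/D$ on $\overline{\mathbb D}$. The royal polynomial of $h$ is $R=4DD^{\sim n}-E^2$ (determined up to a positive factor). The royal nodes of $h$ are exactly the zeros of $R$ in $\overline{\mathbb D}$. When $h(\overline{\mathbb D})\not\subseteq\mathcal R\cap\Gamma$, the multiplicity of a royal node $\sigma$ that is a zero of $R$ of order $\ell$ is $\ell$ if $\sigma\in\mathbb D$ and $\ell/2$ if $\sigma\in\mathbb T$ (in which case $\ell$ is even). Repetitions are allowed in the lists of points. *)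

(* Defs.v *)
From HB Require Import structures.
From mathcomp Require Import all_boot all_order all_algebra.
From mathcomp Require Import all_classical all_reals all_analysis.
From mathcomp Require Export complex.

Set Implicit Arguments.
Unset Strict Implicit.
Unset Printing Implicit Defensive.

Import Order.TTheory GRing.Theory Num.Theory numFieldNormedType.Exports.

Local Open Scope classical_set_scope.
Local Open Scope ring_scope.

(* Topological notions on the complex field R[i] are those of the modulus, which
   the library attaches to the regular module R[i]^o (convertible to R[i]). *)

Definition disc (R : realType) : set R[i] := [set z | `|z| < 1].
Definition cdisc (R : realType) : set R[i] := [set z | `|z| <= 1].
Definition circle (R : realType) : set R[i] := [set z | `|z| = 1].

(* Symmetrized bidisc; Gam is its closure, and bGam, in its explicit description,
   the distinguished (Shilov) boundary of Gam. *)
Definition symG (R : realType) : set (R[i] * R[i]) :=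
  [set x | exists z w : R[i],
     [/\ disc z, disc w & x = (z + w, z * w)]].

Definition Gam (R : realType) : set (R[i] * R[i]) :=
  closure (symG (R := R) : set (R[i]^o * R[i]^o)).

Definition bGam (R : realType) : set (R[i] * R[i]) :=
  [set x | [/\ `|x.1| <= 2, `|x.2| = 1 & x.1 = x.1^* * x.2]].

Definition royal_variety (R : realType) : set (R[i] * R[i]) :=
  [set x | exists z : R[i], x = (2 * z, z ^+ 2)].

Definition rational_on (R : realType) (A : set R[i]) (f : R[i] -> R[i]) : Prop :=
  exists a b : {poly R[i]},
    forall z, A z -> b.[z] != 0 /\ f z = a.[z] / b.[z].

(* Only the values of h on the closed disc matter: h stands for the rational
   map on the open disc together with its continuous extension. *)
Definition rational_Gam_inner (R : realType) (h : R[i] -> R[i] * R[i]) : Prop :=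
  [/\ rational_on (@disc R) (fun z => (h z).1),
      rational_on (@disc R) (fun z => (h z).2),
      {within (@cdisc R : set R[i]^o),
         continuous (h : R[i]^o -> R[i]^o * R[i]^o)},
      (forall z, disc z -> Gam (h z)) &
      (forall z, circle z -> bGam (h z))].

(* Free homotopy, inside X, of the restrictions of f and g to the circle. *)
Definition loop_homotopic (R : realType) (X : set (R[i] * R[i]))
    (f g : R[i] -> R[i] * R[i]) : Prop :=
  exists H : R * R[i] -> R[i] * R[i],
    [/\ {within ([set x | 0 <= x.1 <= 1 /\ `|x.2| = 1] : set (R * R[i]^o)),
           continuous (H : R * R[i]^o -> R[i]^o * R[i]^o)},
        (forall t z, 0 <= t <= 1 -> circle z -> X (H (t, z))) &
        (forall z, circle z -> H (0, z) = f z /\ H (1, z) = g z)].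

(* The set bGam is a Moebius band with core circle {(0, p) | `|p| = 1}, whose
   parametrisation z |-> (0, z) generates the fundamental group Z of bGam.  As
   this group is abelian, classes of loops are free homotopy classes; h_*(1) is
   the class of h restricted to the circle, and `|h_*(1)| = n says that it is
   n or - n times the generator. *)
Definition Gam_degree (R : realType) (h : R[i] -> R[i] * R[i]) (n : nat) : Prop :=
  loop_homotopic (@bGam R) h (fun z => (0, z ^+ n)) \/
  loop_homotopic (@bGam R) h (fun z => (0, z ^- n)).

(* f has order m at z0: f(z) = (z - z0)^m * a(z) / b(z) on the closed disc
   with a and b not vanishing at z0. *)
Definition order_at (R : realType) (f : R[i] -> R[i]) (z0 : R[i]) (m : nat)
    : Prop :=
  exists a b : {poly R[i]},
    [/\ a.[z0] != 0, b.[z0] != 0 &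
        forall z, cdisc z -> f z * b.[z] = (z - z0) ^+ m * a.[z]].

Definition zeros_with_mult (R : realType) (f : R[i] -> R[i]) (s : seq R[i])
    : Prop :=
  (forall z, (cdisc z /\ f z = 0) <-> z \in s) /\
  (forall z, z \in s -> order_at f z (count_mem z s)).

(* f^{~n}(z) = z^n * conj (f (1 / conj z)), for f of degree at most n. *)
Definition reciprocal (R : realType) (n : nat) (f : {poly R[i]}) : {poly R[i]} :=
  \poly_(i < n.+1) (f`_(n - i))^*.

Definition ED_representation (R : realType) (n : nat)
    (h : R[i] -> R[i] * R[i]) (E D : {poly R[i]}) : Prop :=
  [/\ (size E <= n.+1)%N /\ (size D <= n.+1)%N,
      reciprocal n E = E,
      (forall z, cdisc z -> D.[z] != 0),
      (forall z, cdisc z -> `|E.[z]| <= 2 * `|D.[z]|) &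
      (forall z, cdisc z ->
         h z = (E.[z] / D.[z], (reciprocal n D).[z] / D.[z]))].

Definition royal_polynomial (R : realType)
    (h : R[i] -> R[i] * R[i]) (P : {poly R[i]}) : Prop :=
  exists (n : nat) (E D : {poly R[i]}),
    [/\ Gam_degree h n, ED_representation n h E D &
        P = 4 *: (D * reciprocal n D) - E ^+ 2].

Definition royal_node (R : realType) (h : R[i] -> R[i] * R[i]) (z : R[i])
    : Prop :=
  cdisc z /\ royal_variety (h z).

(* On the circle the multiplicity of a node is half the order of the zero of the
   royal polynomial; this order is independent of the choice of that polynomial,
   which is unique up to a positive factor. *)
Definition royal_node_mult (R : realType) (h : R[i] -> R[i] * R[i])
    (z : R[i]) (m : nat) : Prop :=
  exists P : {poly R[i]}, royal_polynomial h P /\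
    mup z P = if `|z| == 1 then (2 * m)%N else m.

Definition royal_nodes_with_mult (R : realType) (h : R[i] -> R[i] * R[i])
    (s : seq R[i]) : Prop :=
  [/\ ~ (forall z, cdisc z -> royal_variety (h z)),
      (forall z, royal_node h z <-> z \in s) &
      (forall z, z \in s -> royal_node_mult h z (count_mem z s))].

(* Main.v *)
Require Import Defs.
From mathcomp Require Import all_boot all_order all_algebra.
From mathcomp Require Import all_classical all_reals all_analysis.
From mathcomp Require Import ring lra zify.

(** Write f~ for the reciprocal of a polynomial f of degree at most n.  On the
    unit circle f~(z) = z^n conj(f(z)), so a polynomial with f~ = f is z^(n/2)
    times a real function there.

    The prescribed zeros of s determine, up to a real factor, a self-reciprocal
    polynomial Z of degree at most n: an interior zero a brings its mirror image
    1/conj(a), which gives the pair (X - a)(1 - conj(a) X), and a zero t on the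
    circle gives a unimodular multiple of X - t ([zero_poly]).  The royal nodes
    determine the polynomial N, the product of all (X - s)(1 - conj(s) X)
    ([node_poly]); on the circle N = z^n prod |z - s|^2, so that
        N + Z^2 = z^n (prod |z - s|^2 + |Z|^2).
    The bracket is positive because no node is a prescribed zero on the circle.
    By the Fejer-Riesz theorem ([fejer_riesz]) N + Z^2 = c D D~ with c > 0 and D
    without zeros in the closed disc.  With E = 2 c^(-1/2) Z this becomes
    4 D D~ - E^2 = (4/c) N, and h = (E/D, D~/D) is the required function: the
    zeros of E and of N in the closed disc are the prescribed ones.

    That h maps the disc into Gamma is a consequence of the maximum principle
    ([maximum_principle]).  On the circle 4 |D|^2 - |E|^2 >= 0, hence |E| <= 2 |D|
    on the closed disc, and for |w| < 1 the function (E - 2 w D~)/(2 D - w E) is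
    bounded by 1 on the circle, hence on the disc ([model_schur]).  A root x of
    x^2 - s x + p with |x| > 1 would violate this bound for w = 1/x, so (s, p)
    is the sum and product of two numbers of modulus at most 1.

    The degree is found by a homotopy inside bGamma which first shrinks s to 0
    and then moves the zeros of the Blaschke product p to the origin, ending at
    (0, z^n) ([model_degree]). *)

Set Implicit Arguments.
Unset Strict Implicit.
Unset Printing Implicit Defensive.

Import Order.TTheory GRing.Theory Num.Theory.
Import numFieldNormedType.Exports.

Local Open Scope classical_set_scope.
Local Open Scope ring_scope.

(** * Continuity of functions with values in a number field *)

Lemma continuous_pair (T U V : topologicalType) (f : T -> U) (g : T -> V) (x : T) :
  {for x, continuous f} -> {for x, continuous g} ->
  {for x, continuous (fun y => (f y, g y))}.
Proof. exact: cvg_pair. Qed.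

Section NumFieldValued.
Context (K : numFieldType) (T : topologicalType).
Implicit Types (f g : T -> K^o) (x : T).

Lemma continuous_mul f g x : {for x, continuous f} -> {for x, continuous g} ->
  {for x, continuous (fun y => f y * g y : K^o)}.
Proof. exact: (@continuousM K). Qed.

Lemma continuous_add f g x : {for x, continuous f} -> {for x, continuous g} ->
  {for x, continuous (fun y => f y + g y : K^o)}.
Proof. exact: (@continuousD K K^o). Qed.

Lemma continuous_inv f x : f x != 0 -> {for x, continuous f} ->
  {for x, continuous (fun y => (f y)^-1 : K^o)}.
Proof. exact: (@continuousV K). Qed.

Lemma continuous_horner_comp (p : {poly K}) f x : {for x, continuous f} ->
  {for x, continuous (fun y => p.[f y] : K^o)}.
Proof.
move=> cf; elim/poly_ind: p => [|p c IH].
  have -> : (fun y => (0 : {poly K}).[f y] : K^o) = cst 0.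
    by apply: funext => z; rewrite horner0.
  exact: cst_continuous.
have -> : (fun y => (p * 'X + c%:P).[f y] : K^o) = fun z => p.[f z] * f z + c.
  by apply: funext => z; rewrite hornerMXaddC.
apply: continuous_add; last exact: cst_continuous.
exact: continuous_mul.
Qed.

Lemma continuous_horner_ratio (p q : {poly K}) f x : q.[f x] != 0 ->
  {for x, continuous f} -> {for x, continuous (fun y => p.[f y] / q.[f y] : K^o)}.
Proof.
move=> q0 cf; apply: continuous_mul; first exact: continuous_horner_comp.
by apply: continuous_inv => //; exact: continuous_horner_comp.
Qed.

Lemma continuous_bigprod (I : eqType) (r : seq I) (F : I -> T -> K^o) x :
  (forall i, i \in r -> {for x, continuous (F i)}) ->
  {for x, continuous (fun y => \prod_(i <- r) F i y : K^o)}.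
Proof.
elim: r => [|i r IH] cF.
  have -> : (fun y => \prod_(i <- [::]) F i y : K^o) = cst 1.
    by apply: funext => z; rewrite big_nil.
  exact: cst_continuous.
have -> : (fun y => \prod_(j <- i :: r) F j y : K^o) =
    fun y => F i y * \prod_(j <- r) F j y.
  by apply: funext => z; rewrite big_cons.
apply: continuous_mul; first by apply: cF; rewrite mem_head.
by apply: IH => j jr; apply: cF; rewrite inE jr orbT.
Qed.

Lemma continuous_moebius_factor f g x (b c : K) : 1 - f x * c * g x != 0 ->
  {for x, continuous f} -> {for x, continuous g} ->
  {for x, continuous (fun y => (g y - f y * b) / (1 - f y * c * g y) : K^o)}.
Proof.
move=> n0 cf cg.
have cN (h : T -> K^o) : {for x, continuous h} ->
    {for x, continuous (fun y => - h y : K^o)}.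
  exact: (@continuousN K K^o).
apply: continuous_mul.
  apply: continuous_add => //; apply: cN; apply: continuous_mul => //.
  exact: cst_continuous.
apply: continuous_inv => //; apply: continuous_add; first exact: cst_continuous.
apply: cN; apply: continuous_mul => //; apply: continuous_mul => //.
exact: cst_continuous.
Qed.

End NumFieldValued.

(** * The maximum principle for rational functions *)

Section MaximumPrinciple.
Context (R : realType).
Local Notation C := R[i].

Lemma continuous_Re : continuous (@complex.Re R : C^o -> R).
Proof.
move=> x; apply: (iffRL (@cvgrPdist_lt R R^o C^o (nbhs (x : C^o))
  (nbhs_filter (x : C^o)) _ _)) => e e0.
have e0' : 0 < e%:C%C by rewrite ltcR.
have xe := @nbhsx_ballx _ C^o x _ e0'.
apply: (@filterS C^o (nbhs (x : C^o)) _ _ _ _ xe) => y xy.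
rewrite -ltcR; apply: le_lt_trans xy.
by rewrite -raddfB; apply: normc_ge_Re.
Qed.

Lemma continuous_complex_of : continuous ((fun u => Complex u.1 u.2) : R * R -> C^o).
Proof.
move=> x. apply/(@cvgrPdist_lt _ C^o) => e e0.
have e0' := gtr0_real e0.
have [d de] := complex_realP _ e0'.
have d0 : 0 < d / 2 by rewrite divr_gt0 //; rewrite de ltcR in e0.
near=> y.
have -> : Complex x.1 x.2 - Complex y.1 y.2 = (x.1 - y.1)%:C%C + 'i%C * (x.2 - y.2)%:C%C.
  by rewrite [LHS]complexE.
apply: le_lt_trans (ler_normD _ _) _.
have -> : e = (d/2)%:C%C + (d/2)%:C%C by rewrite -raddfD /= -splitr.
have nE (t : R) : `|t%:C%C| = `|t|%:C%C :> C.
  by rewrite normc_def /= expr0n /= addr0 sqrtr_sqr.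
have ni : `|'i%C| = 1 :> C by rewrite normc_def /= expr0n expr1n add0r sqrtr1.
rewrite normrM ni mul1r !nE ltrD// ltcR.
  by near: y; apply: (@cvgr_dist_lt R R^o _ _ _ _ _ cvg_fst).
by near: y; apply: (@cvgr_dist_lt R R^o _ _ _ _ _ cvg_snd).
Unshelve. all: by end_near. Qed.

Lemma continuous_real_complex : continuous ((fun t => t%:C%C) : R -> C^o).
Proof.
move=> t; apply: (@continuous_comp R (R * R)%type C^o (fun t => (t, 0))
  (fun u => Complex u.1 u.2)).
  by apply: continuous_pair; [exact: cvg_id|exact: cst_continuous].
exact: continuous_complex_of.
Qed.

(** Near c the quotient f = a/b satisfies f(z)/f(c) = 1 + (z - c)^k G(z) with
    k > 0 and G(c) != 0.  Along the ray on which (z - c)^k G(c) is positive, |f|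
    exceeds |f(c)|. *)
Lemma ratio_increases (a b : {poly C}) (c : C) :
  b.[c] != 0 -> a.[c] != 0 -> b.[c] *: a != a.[c] *: b -> `|c| < 1 ->
  (forall z, `|z| < 1 -> b.[z] != 0) ->
  exists2 z, `|z| < 1 & `|a.[c] / b.[c]| < `|a.[z] / b.[z]|.
Proof.
move=> bc ac; rewrite -subr_eq0; set q := _ - _ => q0 c1 bn0.
have [k [g]] := multiplicity_XsubC q c.
rewrite q0 /= => gc qE.
have k0 : (0 < k)%N.
  rewrite lt0n; apply/eqP => k0; move: gc; rewrite {}k0 expr0 mulr1 in qE.
  by rewrite -qE /root /q !hornerE mulrC subrr eqxx.
pose G z := g.[z] / (a.[c] * b.[z]).
have Gc : G c != 0 by rewrite mulf_neq0// invr_neq0// mulf_neq0.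
have GE z : b.[z] != 0 -> (a.[z] / b.[z]) / (a.[c] / b.[c]) = 1 + (z - c) ^+ k * G z.
  move=> bz; have := congr1 (horner^~ z) qE; rewrite /q !hornerE => qz.
  have {}qz : b.[c] * a.[z] = a.[c] * b.[z] + g.[z] * (z - c) ^+ k.
    by rewrite -qz addrC subrK.
  rewrite /G; apply: (mulfI (mulf_neq0 ac bz)); rewrite mulrDr mulr1.
  transitivity (b.[c] * a.[z]); first by field; rewrite ac bz bc.
  by rewrite qz; set w := _ ^+ k; rewrite /=; field; rewrite ac bz.
have cG : {for c, continuous (G : C^o -> C^o)}.
  apply: (@continuous_mul C C^o).
    by apply: (@continuous_horner_comp C C^o); exact: cvg_id.
  apply: (@continuous_inv C C^o); first exact: mulf_neq0.
  apply: (@continuous_mul C C^o); first exact: cst_continuous.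
  by apply: (@continuous_horner_comp C C^o); exact: cvg_id.
have Gc0 : 0 < `|G c| by rewrite normr_gt0.
have [d d0 dG] : exists2 d : C, 0 < d & forall z, `|c - z| < d -> `|G c - G z| < `|G c|.
  have /(_ _ Gc0) := iffLR (@cvgrPdist_lt C C^o C^o (nbhs (c : C^o))
    (nbhs_filter (c : C^o)) _ _) cG.
  by move=> /(@nbhs_ballP C C^o)[d d0 dG]; exists d => // z; exact: dG.
have e0 : 0 < 1 - `|c| by rewrite subr_gt0.
set e := 1 - `|c| in e0.
(* r is less than both d and e; the order on C is partial, which rules out
   taking half of their minimum. *)
pose r := d * e / (d + e).
have de0 : 0 < d + e by rewrite addr_gt0.
have r0 : 0 < r by rewrite divr_gt0 ?mulr_gt0.
have rd : r < d by rewrite /r ltr_pdivrMr// -subr_gt0 -mulrBr addrK mulr_gt0.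
have re : r < e.
  rewrite /r ltr_pdivrMr// -subr_gt0 [d * e]mulrC -mulrBr addrAC subrr add0r.
  exact: mulr_gt0.
(* u is the direction in which u^k G(c) is positive *)
pose u := k.-root (`|G c| / G c).
have uk : u ^+ k * G c = `|G c| by rewrite rootCK// divfK.
have u1 : `|u| = 1.
  apply/eqP; rewrite -(@pexpr_eq1 _ _ k)// -normrX rootCK// normrM normr_id normfV.
  by rewrite divff// normr_eq0.
pose z := c + r * u.
have zc : z - c = r * u by rewrite /z addrAC subrr add0r.
have nru : `|r * u| = r by rewrite normrM u1 mulr1 gtr0_norm.
have z1 : `|z| < 1.
  apply: le_lt_trans (ler_normD _ _) _; rewrite nru -ltrBrDl; exact: re.
exists z => //.
have acbc : 0 < `|a.[c] / b.[c]| by rewrite normr_gt0 mulf_neq0// invr_neq0.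
rewrite -[ltLHS]mul1r -ltr_pdivlMr// -normf_div GE ?bn0// zc.
have -> : 1 + (r * u) ^+ k * G z = (1 + r ^+ k * `|G c|) - r ^+ k * (u ^+ k * (G c - G z)).
  by rewrite mulrBr uk exprMn mulrBr; ring.
have rk0 : 0 < r ^+ k by rewrite exprn_gt0.
apply: lt_le_trans (lerB_dist _ _).
rewrite ger0_norm; last by rewrite addr_ge0// mulr_ge0// ltW.
rewrite [`|r ^+ k * _|]normrM [`|u ^+ k * _|]normrM !normrX u1 expr1n mul1r.
rewrite (gtr0_norm r0) -addrA ltrDl -mulrBr mulr_gt0// subr_gt0.
by apply: dG; rewrite distrC zc nru.
Qed.

Lemma continuous_modulus : continuous ((fun z => complex.Re `|z|) : C^o -> R).
Proof.
move=> z; apply: (@continuous_comp C^o C^o R (@Num.Def.normr C C^o : C^o -> C^o)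
  (@complex.Re R)).
  exact: (@norm_continuous C C^o).
exact: continuous_Re.
Qed.

(** The closed disc is the image of a closed subset of the square [-1, 1]^2, so
    that its compactness comes down to that of real segments. *)
Lemma compact_EVT_cdisc (f : C^o -> R) : (forall z, cdisc z -> {for z, continuous f}) ->
  exists2 c, cdisc c & forall z, cdisc z -> f z <= f c.
Proof.
move=> cf.
pose h (u : R * R) : C^o := Complex u.1 u.2.
pose A := [set u : R * R | cdisc (h u)].
have AE : A = (fun u => complex.Re `|h u|) @^-1` [set x | x <= 1].
  have E z : cdisc z <-> complex.Re `|z| <= 1.
    by rewrite /cdisc /mkset normc_def -[X in _ <= X]/(1%:C%C) lecR.
  by apply/seteqP; split => u /E.
have clA : closed A.
  rewrite AE; apply: closed_comp => [u _|]; last exact: closed_le.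
  apply: (@continuous_comp _ C^o R h (fun z : C^o => complex.Re `|z|)).
    exact: continuous_complex_of.
  exact: continuous_modulus.
have cA : compact A.
  apply: (subclosed_compact clA).
    exact: compact_setX (@segment_compact R (-1) 1) (@segment_compact R (-1) 1).
  move=> [x y]; rewrite /A /cdisc /h /= normc_def -[X in _ <= X]/(1%:C%C) lecR /= => xy.
  have {}xy : x ^+ 2 + y ^+ 2 <= 1.
    rewrite -[leRHS](expr1n _ 2) -[leLHS]sqr_sqrtr ?addr_ge0 ?sqr_ge0//.
    by rewrite lerXn2r ?nnegrE ?sqrtr_ge0.
  by split; rewrite /= in_itv /=; apply/andP; split; nra.
have A0 : A !=set0.
  by exists (0, 0); rewrite /A /cdisc /h /= -[Complex 0 0]/(0 : C) normr0 ler01.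
have cfh : {within A, continuous (f \o h)}.
  apply: continuous_in_subspaceT => u /set_mem Au.
  apply: continuous_comp; [exact: continuous_complex_of|exact: cf].
have [c cA' cmax] := compact_EVT_max A0 cA cfh.
exists (h c); first exact: (set_mem cA').
case=> x y zd; apply: (cmax (x, y)); exact: mem_set.
Qed.

(** The modulus of a/b attains its maximum over the closed disc; by
    [ratio_increases] it does so at a boundary point, unless a/b is constant and
    can be compared at the point 1. *)
Lemma maximum_principle (a b : {poly C}) :
  (forall z, cdisc z -> b.[z] != 0) ->
  (forall z, circle z -> `|a.[z]| <= `|b.[z]|) ->
  forall z, cdisc z -> `|a.[z]| <= `|b.[z]|.
Proof.
move=> bn0 abT.
pose f (z : C) : C := a.[z] / b.[z].
have cf z : cdisc z -> {for z, continuous (f : C^o -> C^o)}.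
  move=> zd; apply: (@continuous_mul C C^o).
    by apply: (@continuous_horner_comp C C^o); exact: cvg_id.
  apply: (@continuous_inv C C^o); first exact: bn0.
  by apply: (@continuous_horner_comp C C^o); exact: cvg_id.
have [c cd cmax] : exists2 c, cdisc c & forall z, cdisc z -> `|f z| <= `|f c|.
  have [|c cd cmax] := @compact_EVT_cdisc (fun z => complex.Re `|f z|).
    move=> z zd; apply: (@continuous_comp C^o C^o R f (fun z : C^o => complex.Re `|z|)).
      exact: cf.
    exact: continuous_modulus.
  exists c => // z /cmax; rewrite -lecR.
  by rewrite !RRe_real// normr_real.
have fE z : `|f z| = `|a.[z]| / `|b.[z]| by rewrite normf_div.
suff fc1 : `|f c| <= 1.
  move=> z zd; have := le_trans (cmax z zd) fc1.
  by rewrite fE ler_pdivrMr ?mul1r// normr_gt0 bn0.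
have bc := bn0 _ cd.
have [ac|ac] := eqVneq a.[c] 0; first by rewrite /f ac mul0r normr0 ler01.
move: (cd); rewrite /cdisc /mkset le_eqVlt => /orP[/eqP c1|c1].
  by rewrite fE ler_pdivrMr ?normr_gt0// mul1r abT.
have [ab|ab] := eqVneq (b.[c] *: a) (a.[c] *: b).
  have b1 : b.[1] != 0 by apply: bn0; rewrite /cdisc /= normr1.
  have ab1 : `|a.[1]| <= `|b.[1]| by apply: abT; rewrite /circle /= normr1.
  have := congr1 (horner^~ 1) ab; rewrite !hornerZ => /(congr1 Num.Def.normr).
  rewrite fE !normrM => abn; rewrite ler_pdivrMr ?normr_gt0// mul1r.
  rewrite -(ler_pM2r (_ : 0 < `|b.[1]|)) ?normr_gt0// -abn.
  by rewrite ler_wpM2l.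
have [|z z1] := ratio_increases bc ac ab c1.
  by move=> z z1; apply: bn0; exact: ltW.
by move=> /(le_lt_trans (cmax z (ltW z1))); rewrite ltxx.
Qed.

End MaximumPrinciple.

(** * Reciprocal polynomials *)

Section Reciprocal.
Context (R : realType).
Local Notation C := R[i].
Implicit Types (f g p : {poly C}) (z a : C).

(** The functional equation of the reciprocal makes sense away from 0 only, and
    this is enough to determine a polynomial. *)
Lemma polyP_neq0 f g : (forall z, z != 0 -> f.[z] = g.[z]) -> f = g.
Proof.
move=> fg; apply/eqP; rewrite -subr_eq0.
pose r : seq C := [seq i.+1%:R | i <- iota 0 (size (f - g))].
apply/eqP; apply: (@roots_geq_poly_eq0 _ _ r).
- apply/allP => _ /mapP[i _ ->]; rewrite /root hornerD hornerN fg ?subrr ?eqxx//.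
- rewrite map_inj_uniq ?iota_uniq// => i j /eqP; rewrite eqr_nat.
  by move=> /eqP[].
- by rewrite size_map size_iota.
Qed.

Lemma size_reciprocal n f : (size (reciprocal n f) <= n.+1)%N.
Proof. exact: size_poly. Qed.

Lemma horner_reciprocal n f z : (size f <= n.+1)%N -> z != 0 ->
  (reciprocal n f).[z] = z ^+ n * (f.[(z^*)^-1])^*.
Proof.
move=> fn z0; rewrite /reciprocal horner_poly (horner_coef_wide _ fn).
rewrite rmorph_sum mulr_sumr (reindex_inj rev_ord_inj) /=.
apply: eq_bigr => i _; have iln := ltn_ord i; rewrite ltnS in iln.
rewrite rmorphM rmorphXn /= fmorphV /= conjCK subSS subKn// mulrCA; congr (_ * _).
by rewrite exprVn expfB_cond// ?(negPf z0).
Qed.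

Lemma conj_circle z : `|z| = 1 -> z^* = z^-1.
Proof. by move=> z1; rewrite invC_norm z1 expr1n invr1 mul1r. Qed.

Lemma circle_neq0 z : `|z| = 1 -> z != 0.
Proof. by move=> z1; rewrite -normr_gt0 z1. Qed.

Lemma horner_reciprocal_circle n f z : (size f <= n.+1)%N -> `|z| = 1 ->
  (reciprocal n f).[z] = z ^+ n * (f.[z])^*.
Proof.
by move=> fn z1; rewrite horner_reciprocal ?circle_neq0// (conj_circle z1) invrK.
Qed.

Lemma reciprocalM m n f g : (size f <= m.+1)%N -> (size g <= n.+1)%N ->
  reciprocal (m + n) (f * g) = reciprocal m f * reciprocal n g.
Proof.
move=> fm gn; have fg : (size (f * g)%R <= (m + n).+1)%N.
  apply: leq_trans (size_polyMleq _ _) _.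
  by rewrite -ltnS; lia.
apply: polyP_neq0 => z z0.
rewrite hornerM !horner_reciprocal// hornerM rmorphM exprD.
by rewrite -!mulrA; congr (_ * _); rewrite mulrCA.
Qed.

Lemma reciprocalK n f : (size f <= n.+1)%N -> reciprocal n (reciprocal n f) = f.
Proof.
move=> fn; apply/polyP => i; rewrite coef_poly ltnS.
case: leqP => [ilen|nlti]; last by rewrite nth_default// (leq_trans fn).
by rewrite coef_poly ltnS leq_subr subKn// conjCK.
Qed.

Lemma reciprocal_prod (I : Type) (r : seq I) m (F : I -> {poly C}) :
  (forall i, (size (F i) <= m.+1)%N) ->
  (size (\prod_(i <- r) F i)%R <= (m * size r).+1)%N /\
  reciprocal (m * size r) (\prod_(i <- r) F i) = \prod_(i <- r) reciprocal m (F i).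
Proof.
move=> Fm; elim: r => [|i r [IHs IH]].
  rewrite !big_nil muln0 size_poly1; split => //.
  apply/polyP => i; rewrite coef_poly coef1; case: i => [|i] //=.
    by rewrite coef1 conjC1.
  by rewrite coef1.
rewrite !big_cons /= mulnS reciprocalM// IH; split=> //.
apply: leq_trans (size_polyMleq _ _) _; move: (Fm i) IHs => /=.
by set u := size _; set v := size _; set w := (m * _)%N; lia.
Qed.

Lemma size_mirror_factor a : (size (1 - a *: 'X : {poly C})%R <= 2)%N.
Proof.
apply: leq_trans (size_polyD _ _) _; rewrite geq_max size_poly1 size_polyN.
by rewrite (leq_trans (size_scale_leq _ _))// size_polyX.
Qed.

Lemma reciprocal_XsubC a : reciprocal 1 ('X - a%:P) = 1 - a^* *: 'X.
Proof.
apply: polyP_neq0 => z z0; rewrite horner_reciprocal ?size_XsubC// !hornerE.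
by rewrite rmorphB /= fmorphV /= conjCK mulrBr divff// mulrC.
Qed.

Lemma reciprocal_mirror_factor a : reciprocal 1 (1 - a^* *: 'X) = 'X - a%:P.
Proof. by rewrite -reciprocal_XsubC reciprocalK// size_XsubC. Qed.

(** The self-reciprocal polynomial of degree 2 with the two zeros a and
    1/conj(a), which are symmetric in the circle; the second one is at infinity
    if a = 0. *)
Definition mirror_pair a : {poly C} := ('X - a%:P) * (1 - a^* *: 'X).

Lemma size_mirror_pair a : (size (mirror_pair a) <= 3)%N.
Proof.
apply: leq_trans (size_polyMleq _ _) _; rewrite size_XsubC.
by move: (size_mirror_factor a^*); set u := size _; lia.
Qed.

Lemma reciprocal_mirror_pair a : reciprocal 2 (mirror_pair a) = mirror_pair a.
Proof.
rewrite (@reciprocalM 1 1) ?size_XsubC ?size_mirror_factor// reciprocal_XsubC.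
by rewrite reciprocal_mirror_factor mulrC.
Qed.

Lemma horner_mirror_pair_circle a z : `|z| = 1 -> (mirror_pair a).[z] = z * `|z - a| ^+ 2.
Proof.
move=> z1; rewrite normCK rmorphB /= /mirror_pair !hornerE (conj_circle z1).
by rewrite /=; field; exact: circle_neq0.
Qed.

Lemma norm_invconj_lt1 a : 1 < `|a| -> `|(a^*)^-1| < 1.
Proof.
move=> a1; rewrite normfV norm_conjC invf_lt1//; exact: lt_trans a1.
Qed.

Lemma horner_mirror_neq0 a z : `|a| < 1 -> `|z| <= 1 -> 1 - a^* * z != 0.
Proof.
move=> a1 z1; rewrite subr_eq0; apply/eqP => e.
have : `|a^* * z| < 1.
  rewrite normrM norm_conjC; apply: le_lt_trans a1.
  by rewrite -[leRHS]mulr1 ler_wpM2l.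
by rewrite -e normr1 ltxx.
Qed.

Lemma reciprocalD n f g : reciprocal n (f + g) = reciprocal n f + reciprocal n g.
Proof.
apply/polyP => i; rewrite coefD !coef_poly coefD; case: ifP => _; last by rewrite addr0.
by rewrite rmorphD.
Qed.

Lemma reciprocalZ n a f : reciprocal n (a *: f) = a^* *: reciprocal n f.
Proof.
apply/polyP => i; rewrite coefZ !coef_poly coefZ; case: ifP => _; last by rewrite mulr0.
by rewrite rmorphM.
Qed.

Lemma self_reciprocal_prod_mirror_pair (r : seq C) :
  (size (\prod_(b <- r) mirror_pair b)%R <= (2 * size r).+1)%N /\
  reciprocal (2 * size r) (\prod_(b <- r) mirror_pair b) = \prod_(b <- r) mirror_pair b.
Proof.
have [sr ->] := reciprocal_prod r size_mirror_pair; split => //.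
by apply: eq_bigr => b _; exact: reciprocal_mirror_pair.
Qed.

Lemma horner_prod_mirror_pair_circle (r : seq C) z : `|z| = 1 ->
  (\prod_(b <- r) mirror_pair b).[z] = z ^+ size r * \prod_(b <- r) `|z - b| ^+ 2.
Proof.
move=> z1; rewrite horner_prod; under eq_bigr do rewrite horner_mirror_pair_circle//.
by rewrite big_split /= big_const_seq count_predT iter_mulr_1.
Qed.

(** * Fejer-Riesz factorization *)

(** The zeros of a self-reciprocal polynomial are symmetric in the circle; a
    vanishing leading coefficient, which is the conjugate of the constant one,
    stands for a zero at infinity. *)
Lemma self_reciprocal_root n p : (size p <= n.+2)%N -> reciprocal n.+1 p = p ->
  (forall z, `|z| = 1 -> p.[z] != 0) -> exists2 b, `|b| < 1 & root p b.
Proof.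
move=> sp rp pT.
have [p0|p0] := eqVneq p.[0] 0; first by exists 0; rewrite ?normr0// /root p0.
have sp' : size p = n.+2.
  apply/eqP; rewrite eqn_leq sp ltnNge; apply/negP => sp'.
  move: p0; rewrite horner_coef0 -rp coef_poly /= subn0 nth_default//.
  by rewrite conjC0 eqxx.
have /closed_rootP[b pb] : size p != 1%N by rewrite sp'.
have nb : `|b| != 1 by apply/eqP => /pT; rewrite (eqP pb) eqxx.
have [b1|b1] : `|b| < 1 \/ 1 < `|b|.
  by apply/orP; rewrite -real_neqr_lt// normr_real.
  by exists b.
exists (b^*)^-1; first exact: norm_invconj_lt1.
have b0 : b != 0 by rewrite -normr_gt0 (lt_trans _ b1).
rewrite /root -rp horner_reciprocal ?invr_eq0 ?conjC_eq0//.
by rewrite fmorphV /= conjCK invrK (eqP pb) conjC0 mulr0.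
Qed.

(** One mirror pair is split off at a time.  If b is a zero in the disc then
    p = (X - b) q, and reciprocation gives p = (1 - conj(b) X) q~; as the first
    factor does not vanish at b, X - b divides q~. *)
Lemma self_reciprocal_factor n p : (size p <= n.*2.+1)%N ->
  reciprocal n.*2 p = p -> (forall z, `|z| = 1 -> p.[z] != 0) ->
  exists c (r : seq C), [/\ size r = n, forall b, b \in r -> `|b| < 1 &
    p = c *: \prod_(b <- r) mirror_pair b].
Proof.
elim: n p => [|n IH] p sp rp pT.
  exists p`_0, [::]; split => //.
  by rewrite big_nil alg_polyC; exact: size1_polyC.
rewrite doubleS in sp rp.
have [b b1 /factor_theorem[q pq]] := self_reciprocal_root sp rp pT.
have p0 : p != 0.
  by apply/eqP => p0; have := pT 1; rewrite p0 horner0 normr1 eqxx => /(_ erefl).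
have q0 : q != 0 by apply: contraNneq p0 => q0; rewrite pq q0 mul0r.
have sq : (size q <= n.*2.+2)%N.
  by move: sp; rewrite pq size_Mmonic ?monicXsubC// size_XsubC addn2.
have pq' : p = reciprocal n.*2.+1 q * (1 - b^* *: 'X).
  rewrite -[LHS]rp {1}pq -addn1 -reciprocal_XsubC reciprocalM//.
  by rewrite size_XsubC.
have /factor_theorem[g qg] : root (reciprocal n.*2.+1 q) b.
  have := congr1 (horner^~ b) pq'; rewrite pq !hornerE subrr mulr0 => /esym/eqP.
  by rewrite mulf_eq0 (negPf (horner_mirror_neq0 b1 (ltW b1))) orbF.
have pg : p = mirror_pair b * g by rewrite pq' qg /mirror_pair; ring.
have g0 : g != 0 by apply: contraNneq p0 => g0; rewrite pg g0 mulr0.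
have sg : (size g <= n.*2.+1)%N.
  have := size_reciprocal n.*2.+1 q; rewrite qg size_Mmonic ?monicXsubC//.
  by rewrite size_XsubC addn2.
have Bb0 : mirror_pair b != 0 by apply: contraNneq p0 => B0; rewrite pg B0 mul0r.
have [||c [r [sr r1 gr]]] := IH g sg.
- apply: (mulfI Bb0); rewrite -[RHS]pg -[RHS]rp [in RHS]pg -(add2n n.*2).
  by rewrite reciprocalM ?size_mirror_pair// reciprocal_mirror_pair.
- move=> z z1; have := pT z z1; rewrite pg hornerM mulf_eq0 negb_or.
  by case/andP.
exists c, (b :: r); split; first by rewrite /= sr.
  by move=> x; rewrite inE => /predU1P[->|/r1].
by rewrite big_cons pg gr scalerAr.
Qed.

(** The leading constant is positive because both p and the product of mirror
    pairs are z^n times a positive number on the circle. *)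
Lemma fejer_riesz n (p : {poly C}) (f : C -> C) :
  (size p <= (2 * n).+1)%N -> reciprocal (2 * n) p = p ->
  (forall z, `|z| = 1 -> p.[z] = z ^+ n * f z) ->
  (forall z, `|z| = 1 -> 0 < f z) ->
  exists c (r : seq C), [/\ 0 < c, size r = n, forall b, b \in r -> `|b| < 1 &
    p = c *: \prod_(b <- r) mirror_pair b].
Proof.
rewrite mul2n => sp rp pf f0.
have [|c [r [sr r1 pE]]] := self_reciprocal_factor sp rp.
  move=> z z1; rewrite pf// mulf_neq0 ?(lt0r_neq0 (f0 _ z1))// expf_neq0//.
  exact: circle_neq0.
exists c, r; split => //.
have n1 := @normr1 C.
have := f0 1 n1; have := pf 1 n1; rewrite pE hornerZ horner_prod_mirror_pair_circle//.
rewrite !expr1n !mul1r => <-; rewrite pmulr_lgt0//.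
rewrite big_seq; apply: prodr_gt0 => b /r1 b1.
rewrite exprn_gt0// normr_gt0 subr_eq0; apply: contraTneq b1 => <-.
by rewrite n1 ltxx.
Qed.

End Reciprocal.

(** * The rational map attached to E and a Blaschke product *)

Section Construction.
Context (R : realType).
Local Notation C := R[i].

Definition blaschke_den (r : seq C) : {poly C} := \prod_(b <- r) (1 - b^* *: 'X).
Definition blaschke_num (r : seq C) : {poly C} := \prod_(b <- r) ('X - b%:P).

Lemma size_blaschke_den r : (size (blaschke_den r) <= (size r).+1)%N.
Proof.
have [] := @reciprocal_prod R _ r 1 (fun b => 1 - b^* *: 'X)
  (fun b => size_mirror_factor b^*).
by rewrite mul1n.
Qed.

Lemma reciprocal_blaschke_den r : reciprocal (size r) (blaschke_den r) = blaschke_num r.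
Proof.
have [_] := @reciprocal_prod R _ r 1 (fun b => 1 - b^* *: 'X)
  (fun b => size_mirror_factor b^*).
by rewrite mul1n => ->; apply: eq_bigr => b _; exact: reciprocal_mirror_factor.
Qed.

Lemma horner_blaschke_den r z : (blaschke_den r).[z] = \prod_(b <- r) (1 - b^* * z).
Proof. by rewrite horner_prod; apply: eq_bigr => b _; rewrite !hornerE. Qed.

Lemma horner_blaschke_num r z : (blaschke_num r).[z] = \prod_(b <- r) (z - b).
Proof. by rewrite horner_prod; apply: eq_bigr => b _; rewrite !hornerE. Qed.

Lemma blaschke_den_neq0 r : (forall b, b \in r -> `|b| < 1) ->
  forall z, `|z| <= 1 -> (blaschke_den r).[z] != 0.
Proof.
move=> r1 z z1; rewrite horner_blaschke_den prodf_seq_neq0; apply/allP => b /r1 b1 /=.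
exact: horner_mirror_neq0.
Qed.

Lemma prod_mirror_pairE (r : seq C) : \prod_(b <- r) mirror_pair b =
  blaschke_num r * blaschke_den r.
Proof. by rewrite -big_split. Qed.

Lemma conj_real_complex (t : R) : (t%:C%C : C)^* = t%:C%C.
Proof. by apply: conj_Creal; apply/complex_realP; exists t. Qed.

Lemma norm_moebius (a z : C) : `|z| = 1 -> `|z - a| = `|1 - a^* * z|.
Proof.
move=> z1; have -> : 1 - a^* * z = (z - a)^* * z.
  by rewrite rmorphB /= (conj_circle z1) mulrBl mulVf// circle_neq0.
by rewrite normrM norm_conjC z1 mulr1.
Qed.

(** Here D is normalized to be [blaschke_den r], whose zeros are the mirror images
    of the points of r, so that p = D~/D is a Blaschke product. *)
Section Model.
Context (r : seq C) (E : {poly C}).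
Context (r_disc : forall b, b \in r -> `|b| < 1).
Context (size_E : (size E <= (size r).+1)%N).
Context (rec_E : reciprocal (size r) E = E).
Context (E_le_den : forall z, `|z| = 1 -> `|E.[z]| <= 2 * `|(blaschke_den r).[z]|).

Definition model (z : C) : C * C :=
  (E.[z] / (blaschke_den r).[z], (blaschke_num r).[z] / (blaschke_den r).[z]).

Lemma E_le_den_disc z : `|z| <= 1 -> `|E.[z]| <= 2 * `|(blaschke_den r).[z]|.
Proof.
have EE w : `|(2 *: blaschke_den r).[w]| = 2 * `|(blaschke_den r).[w]|.
  by rewrite hornerZ normrM normr_nat.
move=> z1; rewrite -EE; apply: (maximum_principle _ _ z1) => w w1.
  by rewrite hornerZ mulf_neq0 ?pnatr_eq0// blaschke_den_neq0.
by rewrite EE E_le_den.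
Qed.

Lemma model_ED : ED_representation (size r) model E (blaschke_den r).
Proof.
split => //; first by split => //; exact: size_blaschke_den.
- exact: blaschke_den_neq0.
- exact: E_le_den_disc.
- by move=> z _; rewrite reciprocal_blaschke_den.
Qed.

Lemma E_circle z : `|z| = 1 -> E.[z] = z ^+ size r * (E.[z])^*.
Proof. by move=> z1; rewrite -{1}rec_E horner_reciprocal_circle. Qed.

Lemma blaschke_num_circle z : `|z| = 1 ->
  (blaschke_num r).[z] = z ^+ size r * ((blaschke_den r).[z])^*.
Proof.
move=> z1; rewrite -reciprocal_blaschke_den.
by rewrite horner_reciprocal_circle ?size_blaschke_den.
Qed.

Lemma model_circle z : circle z -> bGam (model z).
Proof.
move=> z1; have z1' : `|z| <= 1 by rewrite z1.
have d0 := blaschke_den_neq0 r_disc z1'.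
split => /=.
- by rewrite normf_div ler_pdivrMr ?normr_gt0// E_le_den.
- rewrite blaschke_num_circle// normrM normfV normrM normrX z1 expr1n mul1r norm_conjC.
  by rewrite divff// normr_eq0.
- rewrite blaschke_num_circle// {1}E_circle// rmorphM fmorphV /=; field.
  by rewrite conjC_eq0 d0.
Qed.

Lemma schur_den_neq0 (w z : C) : `|w| < 1 -> `|z| <= 1 ->
  (2 *: blaschke_den r - w *: E).[z] != 0.
Proof.
move=> w1 z1; rewrite !hornerE subr_eq0; apply/eqP => e.
have d0 := blaschke_den_neq0 r_disc z1.
have := E_le_den_disc z1; rewrite -[2](@normr_nat C) -normrM e normrM.
move=> /le_gtF/negP; apply.
have E0 : 0 < `|E.[z]|.
  rewrite normr_gt0; apply: contra_neq d0 => E0.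
  by move/eqP: e; rewrite E0 mulr0 mulf_eq0 pnatr_eq0 /= => /eqP.
by rewrite gtr_pMl.
Qed.

(** In terms of s and p this says |s - 2 w p| <= |2 - w s|.  On the circle the
    squared moduli of 2 D - w E and E - 2 w D~ differ by
    (1 - |w|^2)(4 |D|^2 - |E|^2), which is nonnegative. *)
Lemma model_schur (w z : C) : `|w| < 1 -> `|z| <= 1 ->
  `|(E - (2 * w) *: blaschke_num r).[z]| <= `|(2 *: blaschke_den r - w *: E).[z]|.
Proof.
move=> w1 z1; apply: (maximum_principle _ _ z1) => {z z1} z z1.
  exact: schur_den_neq0.
have z1n := z1; rewrite /circle /mkset in z1n.
rewrite -(@ler_pXn2r _ 2) ?nnegrE// -subr_ge0 !normCK !hornerE.
set e := E.[z]; set d := (blaschke_den r).[z].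
have zn0 : z ^+ size r != 0 by rewrite expf_neq0// circle_neq0.
have -> : (blaschke_num r).[z] = z ^+ size r * d^* by exact: blaschke_num_circle.
have ee : e = z ^+ size r * e^* by exact: E_circle.
have cz : (z ^+ size r)^* = (z ^+ size r)^-1 by rewrite rmorphXn /= conj_circle// exprVn.
move: (z ^+ size r) zn0 ee cz => x x0 ee cx.
rewrite !rmorphB !rmorphM /= cx !conjC_nat conjCK.
set e' := e^* in ee *; set d' := d^*; set w' := w^*.
have -> : (2 * d - w * e) * (2 * d' - w' * e') -
   (e - 2 * w * (x * d')) * (e' - 2 * w' * (x^-1 * d)) =
   (1 - w * w') * (4 * (d * d') - e * e') by rewrite {}ee; field.
rewrite -!normCK; apply: mulr_ge0; rewrite subr_ge0.
  by rewrite expr_le1// ltW.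
have -> : 4 = 2 ^+ 2 :> C by rewrite -natrX.
by rewrite -exprMn ler_pXn2r ?nnegrE ?mulr_ge0// E_le_den.
Qed.

(** A root x of X^2 - s X + p satisfies 2 - s/x = (s - 2 p/x)/x, which
    for |x| > 1 contradicts the bound of [model_schur] at w = 1/x. *)
Lemma model_root_le1 (z x : C) : `|z| <= 1 ->
  x ^+ 2 - (model z).1 * x + (model z).2 = 0 -> `|x| <= 1.
Proof.
move=> z1 /= xz; rewrite real_leNgt ?normr_real//; apply/negP => x1.
have x0 : x != 0 by rewrite -normr_gt0 (lt_trans _ x1).
have w1 : `|x^-1| < 1 by rewrite normfV invf_lt1// (lt_trans _ x1).
have d0 := blaschke_den_neq0 r_disc z1.
have := model_schur w1 z1; have := schur_den_neq0 w1 z1.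
have -> : (2 *: blaschke_den r - x^-1 *: E).[z] =
    x^-1 * (E - (2 * x^-1) *: blaschke_num r).[z].
  have dx : (blaschke_den r).[z] * x ^+ 2 - E.[z] * x + (blaschke_num r).[z] = 0.
    transitivity ((blaschke_den r).[z] *
      (x ^+ 2 - E.[z] / (blaschke_den r).[z] * x + (blaschke_num r).[z] / (blaschke_den r).[z])).
      by field.
    by rewrite xz mulr0.
  have {}dx : (blaschke_num r).[z] = E.[z] * x - (blaschke_den r).[z] * x ^+ 2.
    by rewrite -[RHS](addr0) -dx; ring.
  by rewrite !hornerE dx /=; field.
move=> b0; rewrite normrM => /le_gtF/negP; apply.
rewrite gtr_pMl// normr_gt0; apply: contraNneq b0 => ->.
by rewrite mulr0.
Qed.

(** Shrinking both numbers by a factor less than 1 moves the point into the open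
    symmetrized bidisc. *)
Lemma closure_symG (s p w1 w2 : C) : s = w1 + w2 -> p = w1 * w2 ->
  `|w1| <= 1 -> `|w2| <= 1 -> Gam (s, p).
Proof.
move=> -> -> w1l w2l B nB.
pose f (x : C^o) : C^o * C^o := (x * (w1 + w2), x * x * (w1 * w2)).
have cf : {for 1, continuous f}.
  apply: (@continuous_pair C^o C^o C^o).
    apply: (@continuous_mul C C^o); [exact: cvg_id|exact: cst_continuous].
  apply: (@continuous_mul C C^o); last exact: cst_continuous.
  by apply: (@continuous_mul C C^o); exact: cvg_id.
have : nbhs (1 : C^o) (f @^-1` B) by apply: cf; rewrite /f !mul1r.
move=> /(@nbhs_ballP C C^o)[d d0 dB].
have d1 : 0 < 1 + d by rewrite addr_gt0.
pose x := (1 + d)^-1.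
have x0 : 0 < x by rewrite invr_gt0.
have x1 : x < 1 by rewrite invf_lt1// ltrDl.
have bx : `|1 - x| < d.
  rewrite ger0_norm ?subr_ge0 ?(ltW x1)//.
  have -> : 1 - x = d * x by rewrite /x; field; rewrite gt_eqF.
  by rewrite gtr_pMr.
exists (f x); split; last exact: (dB x bx).
have dw (w : C) : `|w| <= 1 -> disc (x * w).
  move=> w1'; rewrite /disc /mkset normrM gtr0_norm//.
  by apply: le_lt_trans x1; rewrite ler_piMr// ltW.
exists (x * w1), (x * w2); split; [exact: dw|exact: dw|].
by rewrite /f; congr (_, _); ring.
Qed.

Lemma model_disc z : `|z| <= 1 -> Gam (model z).
Proof.
move=> z1; have rl := @model_root_le1 z _ z1.
case: (model z) rl => s p /= rl.
pose q := sqrtC (s ^+ 2 - 4 * p).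
have qq : q ^+ 2 = s ^+ 2 - 4 * p by rewrite sqrtCK.
have pE : p = (s ^+ 2 - q ^+ 2) / 4 by rewrite qq; field.
apply: (@closure_symG _ _ ((s + q) / 2) ((s - q) / 2)).
- by field.
- by rewrite pE; field.
- by apply: rl; rewrite pE; field.
- by apply: rl; rewrite pE; field.
Qed.

Lemma model_continuous : {within (@cdisc R : set C^o),
  continuous (model : C^o -> C^o * C^o)}.
Proof.
apply: continuous_in_subspaceT => z /set_mem z1.
have cr (p : {poly C}) :
    {for z, continuous (fun y : C^o => p.[y] / (blaschke_den r).[y] : C^o)}.
  apply: (@continuous_horner_ratio C C^o p (blaschke_den r) id).
    exact: blaschke_den_neq0.
  exact: cvg_id.
exact: (continuous_pair (cr E) (cr (blaschke_num r))).
Qed.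

Lemma model_Gam_inner : rational_Gam_inner model.
Proof.
split.
- by exists E, (blaschke_den r) => z /ltW z1; split=> //; exact: blaschke_den_neq0.
- exists (blaschke_num r), (blaschke_den r) => z /ltW z1; split=> //.
  exact: blaschke_den_neq0.
- exact: model_continuous.
- by move=> z /ltW; exact: model_disc.
- exact: model_circle.
Qed.

(** The contraction of s to 0 stays in bGamma because s = conj(s) p is preserved
    by real factors; once s = 0 the only constraint left is |p| = 1, and the zeros
    of the Blaschke product p can be moved to the origin. *)
Lemma model_degree : Gam_degree model (size r).
Proof.
left.
(* u goes from 1 to 0 in the first half of the time, v in the second half *)
pose u (t : R) : R := Num.max 0 (1 - 2 * t).
pose v (t : R) : R := 1 - Num.max 0 (2 * t - 1).
pose H (x : R * C) : C * C := ((u x.1)%:C%C * (model x.2).1,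
  \prod_(b <- r) ((x.2 - (v x.1)%:C%C * b) / (1 - (v x.1)%:C%C * b^* * x.2))).
have v01 t : 0 <= t <= 1 -> 0 <= v t <= 1.
  by rewrite /v; case: (leP 0 (2 * t - 1)); lra.
have nz (t : R) z b : 0 <= t <= 1 -> b \in r -> `|z| <= 1 -> 1 - t%:C%C * b^* * z != 0.
  move=> /andP[t0 t1] /r_disc b1 z1.
  have -> : t%:C%C * b^* = (t%:C%C * b)^* by rewrite rmorphM /= conj_real_complex.
  apply: horner_mirror_neq0 => //; rewrite normrM ger0_norm ?ler0c//.
  apply: le_lt_trans b1; rewrite ler_piMl// -[1]/(1%:C%C) lecR//.
have Hv1 t z : v t = 1 -> H (t, z) = ((u t)%:C%C * (model z).1, (model z).2).
  move=> v1; rewrite /H /= v1 horner_blaschke_num horner_blaschke_den -prodf_div.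
  congr (_, _).
  by apply: eq_bigr => b _; rewrite !mul1r.
exists H; split.
- apply: continuous_in_subspaceT => -[t z] /set_mem[/= t01 z1].
  have cz : {for (t, z), continuous (fun x : R * C^o => x.2)} by exact: cvg_snd.
  have cC (g : R -> R) : {for t, continuous g} ->
     {for (t, z), continuous (fun x : R * C^o => (g x.1)%:C%C : C^o)}.
    move=> cg; apply: (@continuous_comp _ R C^o (fun x => g x.1) (fun y => y%:C%C)).
      by apply: (@continuous_comp _ R R fst g) => //; exact: cvg_fst.
    exact: continuous_real_complex.
  have cmax (a b : R) : {for t, continuous (fun t => Num.max 0 (a * t + b) : R^o)}.
    apply: (@continuous_max _ _ (cst 0) (fun t => a * t + b)); first exact: cst_continuous.
    apply: (@continuous_add R R); last exact: cst_continuous.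
    by apply: (@continuous_mul R R); [exact: cst_continuous|exact: cvg_id].
  have cu : {for t, continuous u}.
    have -> : u = fun t => Num.max 0 (- 2 * t + 1).
      by apply: funext => y; rewrite /u mulNr addrC.
    exact: cmax.
  have cv : {for t, continuous v}.
    have -> : v = fun t => 1 - Num.max 0 (2 * t + (- 1)) by [].
    by apply: (@continuousB R R^o R); [exact: cst_continuous|exact: cmax].
  have c1 : {for (t, z), continuous (fun x : R * C^o =>
      (u x.1)%:C%C * (E.[x.2] / (blaschke_den r).[x.2]) : C^o)}.
    apply: (@continuous_mul C (R * C^o)%type (fun x => (u x.1)%:C%C)
      (fun x => E.[x.2] / (blaschke_den r).[x.2])); first exact: cC.
    apply: (@continuous_horner_ratio C (R * C^o)%type E (blaschke_den r) snd) => //.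
    by apply: blaschke_den_neq0; rewrite ?z1.
  have c2 : {for (t, z), continuous (fun x : R * C^o =>
      \prod_(b <- r) ((x.2 - (v x.1)%:C%C * b) / (1 - (v x.1)%:C%C * b^* * x.2)) : C^o)}.
    apply: (@continuous_bigprod C (R * C^o)%type _ r
      (fun b x => (x.2 - (v x.1)%:C%C * b) / (1 - (v x.1)%:C%C * b^* * x.2))) => b br.
    have z1' : `|z| <= 1 by rewrite z1.
    have n0 := nz _ _ _ (v01 _ t01) br z1'.
    exact: (@continuous_moebius_factor C (R * C^o)%type (fun x => (v x.1)%:C%C) snd
      (t, z) b b^* n0 (cC _ cv) cz).
  exact: (continuous_pair c1 c2).
- move=> t z t01 z1; have z1' : `|z| <= 1 by rewrite z1.
  have [t2|t2] := leP (1 - 2 * t) 0.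
    have u0 : u t = 0 by rewrite /u; apply/max_idPl.
    split; rewrite /= ?u0 /= ?mul0r ?normr0 ?conjC0 ?mul0r//.
    rewrite normr_prod big_seq big1// => b br.
    rewrite normf_div; have := nz _ _ _ (v01 _ t01) br z1'.
    have -> : (v t)%:C%C * b^* = ((v t)%:C%C * b)^*.
      by rewrite rmorphM /= conj_real_complex.
    rewrite (norm_moebius _ z1) -normr_eq0 => ?; exact: divff.
  have v1 : v t = 1 by rewrite /v (max_idPl _) ?subr0//; lra.
  rewrite Hv1//; have := model_circle z1; case: (model z) => s p [/= s2 p1 sp].
  have u01 : 0 <= u t <= 1.
    by rewrite /u; case: (leP 0 (1 - 2 * t)); lra.
  have uC : 0 <= (u t)%:C%C <= (1 : C) by rewrite ler0c -[1]/(1%:C%C) lecR.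
  case/andP: uC => uC0 uC1.
  split => //=.
    rewrite normrM ger0_norm//; apply: le_trans s2; exact: ler_piMl.
  by rewrite {1}sp rmorphM /= conj_real_complex mulrA.
- move=> z z1; split.
    rewrite Hv1 /u /v; last by rewrite (max_idPl _) ?subr0//; lra.
    rewrite (max_idPr _); last by lra.
    by rewrite mulr0 subr0 mul1r; case: (model z).
  rewrite /H /= /u /v (max_idPl _); last by lra.
  rewrite (max_idPr _) ?mul0r; last by lra.
  have -> : 1 - (2 * 1 - 1) = 0 :> R by ring.
  congr (_, _); under eq_bigr do rewrite !mul0r !subr0 divr1.
  by rewrite big_const_seq count_predT iter_mulr_1.
Qed.
End Model.
End Construction.

(** * Multiplicities of zeros *)

Section Multiplicity.
Context (R : realType).
Local Notation C := R[i].
Implicit Types (p : {poly C}) (z a t : C).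

Lemma mup_factor p z : p != 0 ->
  exists2 q, q.[z] != 0 & p = q * ('X - z%:P) ^+ mup z p.
Proof.
move=> p0; have [m [q]] := multiplicity_XsubC p z; rewrite p0 /= => qz pE.
exists q => //; suff -> : mup z p = m by [].
by rewrite pE mupMr// mup_XsubCX eqxx.
Qed.

Lemma root_mup p z : p != 0 -> (p.[z] == 0) = (0 < mup z p)%N.
Proof. by move=> p0; rewrite -XsubC_dvd// dvdp_XsubCl. Qed.

Lemma mupZ c p z : c != 0 -> mup z (c *: p) = mup z p.
Proof. by move=> c0; rewrite -mul_polyC mupMr// rootC. Qed.

Lemma mup_prod (I : eqType) (r : seq I) (F : I -> {poly C}) z :
  (forall i, i \in r -> F i != 0) ->
  mup z (\prod_(i <- r) F i) = (\sum_(i <- r) mup z (F i))%N.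
Proof.
elim: r => [|i r IH] F0; first by rewrite !big_nil mupNroot ?root1.
have F0r j : j \in r -> F j != 0 by move=> jr; apply: F0; rewrite inE jr orbT.
rewrite !big_cons mupM ?IH//; first by apply: F0; rewrite mem_head.
by rewrite prodf_seq_neq0; apply/allP => j /F0r.
Qed.

Lemma mirror_factor_neq0 a : 1 - a^* *: 'X != 0 :> {poly C}.
Proof.
apply: contraTneq (oner_neq0 C) => /(congr1 (horner^~ 0)).
by rewrite !hornerE ?mulr0 ?subr0 => ->; rewrite eqxx.
Qed.

Lemma mirror_pair_neq0 a : mirror_pair a != 0.
Proof. by rewrite mulf_neq0 ?mirror_factor_neq0 ?polyXsubC_eq0. Qed.

Lemma mup_mirror_factor a z : `|a| <= 1 -> `|z| <= 1 ->
  mup z (1 - a^* *: 'X) = (`|z| == 1) && (a == z) :> nat.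
Proof.
move=> a1 z1; have [<-{z1 z}|az] := eqVneq a z; last first.
  rewrite andbF mupNroot// /root !hornerE.
  move: a1; rewrite le_eqVlt => /orP[/eqP a1|a1]; last exact: horner_mirror_neq0.
  apply: contraNneq az => az; apply/eqP.
  have a0 := circle_neq0 a1; apply: (mulfI (_ : a^* != 0)); first by rewrite conjC_eq0.
  have -> : a^* * a = 1 by rewrite (conj_circle a1) mulVf.
  by apply/eqP; rewrite -subr_eq0 az.
rewrite andbT; have [na|na] := eqVneq `|a| 1.
  have -> : 1 - a^* *: 'X = (- a^*) *: ('X - a%:P).
    rewrite scalerBr -!mul_polyC -polyCM mulNr (conj_circle na) mulVf ?circle_neq0//.
    by rewrite !polyCN mulNr opprK addrC.
  rewrite mupZ ?oppr_eq0 ?conjC_eq0 ?circle_neq0//.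
  by have := mup_XsubCX 1 a a; rewrite expr1 eqxx.
rewrite mupNroot// /root !hornerE; apply: horner_mirror_neq0 => //.
by rewrite lt_neqAle na.
Qed.

(** On the circle the zeros a and 1/conj(a) coincide, whence the double count. *)
Lemma mup_mirror_pair a z : `|a| <= 1 -> `|z| <= 1 ->
  mup z (mirror_pair a) = if `|z| == 1 then (a == z).*2 else (a == z).
Proof.
move=> a1 z1; rewrite mupM ?polyXsubC_eq0 ?mirror_factor_neq0// mup_mirror_factor//.
rewrite -['X - _]expr1 mup_XsubCX.
by case: (`|z| == 1); case: (a == z).
Qed.

Lemma mup_prod_mirror_pair (r : seq C) z : (forall a, a \in r -> `|a| <= 1) -> `|z| <= 1 ->
  mup z (\prod_(a <- r) mirror_pair a) =
  if `|z| == 1 then (2 * count_mem z r)%N else count_mem z r.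
Proof.
move=> r1 z1; rewrite mup_prod => [|a _]; last exact: mirror_pair_neq0.
under eq_big_seq => a ar do rewrite (mup_mirror_pair (r1 a ar) z1).
rewrite -sum1_count; case: ifP => _; last by rewrite [RHS]big_mkcond.
rewrite [in RHS]big_mkcond big_distrr /=; apply: eq_bigr => a _.
by case: (a == z).
Qed.

(** The reciprocal of X - t is - conj(t) (X - t) for t on the circle, and the
    square root of - conj(t) absorbs this factor. *)
Definition circle_factor t : {poly C} := sqrtC (- t^*) *: ('X - t%:P).

Lemma sqrtC_circle_neq0 t : `|t| = 1 -> sqrtC (- t^*) != 0.
Proof. by move=> t1; rewrite sqrtC_eq0 oppr_eq0 conjC_eq0 circle_neq0. Qed.

Lemma size_circle_factor t : (size (circle_factor t) <= 2)%N.
Proof. by rewrite (leq_trans (size_scale_leq _ _))// size_XsubC. Qed.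

Lemma reciprocal_circle_factor t : `|t| = 1 ->
  reciprocal 1 (circle_factor t) = circle_factor t.
Proof.
move=> t1; have t0 := circle_neq0 t1.
have s1 : `|sqrtC (- t^*)| = 1.
  apply/eqP; rewrite -(@pexpr_eq1 _ _ 2)// -normrX sqrtCK normrN norm_conjC.
  by rewrite t1.
rewrite reciprocalZ reciprocal_XsubC /circle_factor.
have -> : 1 - t^* *: 'X = (sqrtC (- t^*)) ^+ 2 *: ('X - t%:P).
  rewrite sqrtCK scalerBr -!mul_polyC -polyCM mulNr (conj_circle t1) mulVf//.
  by rewrite !polyCN mulNr opprK addrC.
by rewrite scalerA expr2 mulrA [_^* * _]mulrC -normCK s1 expr1n mul1r.
Qed.

Lemma circle_factor_neq0 t : `|t| = 1 -> circle_factor t != 0.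
Proof. by move=> t1; rewrite scaler_eq0 negb_or polyXsubC_eq0 sqrtC_circle_neq0. Qed.

Lemma mup_prod_circle_factor (r : seq C) z : (forall t, t \in r -> `|t| = 1) ->
  mup z (\prod_(t <- r) circle_factor t) = count_mem z r.
Proof.
move=> r1; rewrite mup_prod => [|t /r1]; last exact: circle_factor_neq0.
rewrite -sum1_count [RHS]big_mkcond /=; apply: eq_big_seq => t /r1 t1.
rewrite mupZ ?sqrtC_circle_neq0// -['X - _]expr1 mup_XsubCX.
by case: (t == z).
Qed.

End Multiplicity.

(** * Prescribed zeros and royal nodes *)

Section Prescribed.
Context (R : realType).
Local Notation C := R[i].

Lemma royal_varietyE (s p : C) : royal_variety (s, p) <-> s ^+ 2 = 4 * p.
Proof.
split => [[z [-> ->]]|sp]; first by ring.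
exists (s / 2); congr (_, _); first by field.
by apply: (mulfI (_ : 4 != 0)); rewrite ?pnatr_eq0// -sp; field.
Qed.

(** The closed disc is infinite: it contains all 1/(i+1). *)
Lemma seq_avoid (s : seq C) : exists2 z : C, `|z| <= 1 & z \notin s.
Proof.
pose e : seq C := [seq (i.+1%:R)^-1 | i <- iota 0 (size s).+1].
have ue : uniq e.
  rewrite map_inj_uniq ?iota_uniq// => i j /invr_inj/eqP.
  by rewrite eqr_nat eqSS => /eqP.
have [|/allPn[z /mapP[i _ zE] zs]] := boolP (all [in s] e).
  by move=> /allP/(uniq_leq_size ue); rewrite size_map size_iota ltnn.
exists z => //; rewrite zE normfV normr_nat invf_le1 ?ltr0Sn// ler1n//.
Qed.

Section Data.
Context (alpha tau sigma : seq C).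
Context (alpha_disc : forall a, a \in alpha -> `|a| < 1).
Context (tau_circle : forall t, t \in tau -> `|t| = 1).
Context (sigma_cdisc : forall s, s \in sigma -> `|s| <= 1).
Context (sigma_tau : forall s t, s \in sigma -> t \in tau -> s <> t).
Context (size_balance : (2 * size alpha + size tau = size sigma)%N).
Local Notation n := (size sigma).

Definition zero_poly : {poly C} :=
  (\prod_(a <- alpha) mirror_pair a) * \prod_(t <- tau) circle_factor t.

Definition node_poly : {poly C} := \prod_(s <- sigma) mirror_pair s.

Lemma zero_poly_self_reciprocal :
  (size zero_poly <= n.+1)%N /\ reciprocal n zero_poly = zero_poly.
Proof.
have [sA rA] := self_reciprocal_prod_mirror_pair alpha.
have [sT rT] := reciprocal_prod tau (@size_circle_factor R).
rewrite mul1n in sT rT.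
rewrite /zero_poly -size_balance; split.
  apply: leq_trans (size_polyMleq _ _) _.
  by move: sA sT; set u := size _; set v := size _; lia.
rewrite reciprocalM// rA rT; congr (_ * _); apply: eq_big_seq => t /tau_circle.
exact: reciprocal_circle_factor.
Qed.

Lemma zero_poly_neq0 : zero_poly != 0.
Proof.
apply: mulf_neq0; rewrite prodf_seq_neq0; apply/allP.
  by move=> a _; exact: mirror_pair_neq0.
by move=> t /tau_circle; exact: circle_factor_neq0.
Qed.

Lemma node_poly_neq0 : node_poly != 0.
Proof. by rewrite prodf_seq_neq0; apply/allP => s _; exact: mirror_pair_neq0. Qed.

Lemma mup_zero_poly z : `|z| <= 1 -> mup z zero_poly = count_mem z (alpha ++ tau).
Proof.
move=> z1; have := zero_poly_neq0; rewrite mulf_eq0 negb_or => /andP[A0 T0].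
rewrite mupM// mup_prod_circle_factor; last exact: tau_circle.
rewrite mup_prod_mirror_pair//; last by move=> a /alpha_disc/ltW.
rewrite count_cat; case: eqP => // z1'; congr addn.
suff : z \notin alpha by move/count_memPn => ->.
by apply/negP => /alpha_disc; rewrite z1' ltxx.
Qed.

Lemma mup_node_poly z : `|z| <= 1 ->
  mup z node_poly = if `|z| == 1 then (2 * count_mem z sigma)%N else count_mem z sigma.
Proof. by move=> z1; apply: mup_prod_mirror_pair => // s /sigma_cdisc. Qed.

Lemma root_zero_poly z : `|z| <= 1 -> (zero_poly.[z] == 0) = (z \in alpha ++ tau).
Proof.
move=> z1; rewrite root_mup ?zero_poly_neq0// mup_zero_poly//.
by rewrite -has_count has_pred1.
Qed.

Lemma root_node_poly z : `|z| <= 1 -> (node_poly.[z] == 0) = (z \in sigma).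
Proof.
move=> z1; rewrite root_mup ?node_poly_neq0// mup_node_poly// -has_pred1 has_count.
by case: ifP => // _; rewrite muln_gt0.
Qed.

(** On the circle the left-hand side is z^n (prod |z - s|^2 + |Z|^2); the two
    terms of the bracket could only vanish together at a common point of sigma
    and tau. *)
Lemma spectral_factorization : exists c (r : seq C), [/\ 0 < c, size r = n,
  forall b, b \in r -> `|b| < 1 &
  node_poly + zero_poly ^+ 2 = c *: \prod_(b <- r) mirror_pair b].
Proof.
have [sN rN] := self_reciprocal_prod_mirror_pair sigma.
have [sZ rZ] := zero_poly_self_reciprocal.
pose f (z : C) := \prod_(s <- sigma) `|z - s| ^+ 2 + `|zero_poly.[z]| ^+ 2.
apply: (@fejer_riesz R n _ f) => [||z z1|z z1].
- apply: leq_trans (size_polyD _ _) _; rewrite geq_max sN /=.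
  apply: leq_trans (size_polyMleq _ _) _.
  by move: sZ; set u := size _; lia.
- by rewrite reciprocalD rN mul2n -addnn reciprocalM// rZ.
- rewrite hornerD horner_prod_mirror_pair_circle// expr2 hornerM -{1}rZ.
  by rewrite horner_reciprocal_circle// /f normCK; ring.
- have P0 : 0 <= \prod_(s <- sigma) `|z - s| ^+ 2.
    by apply: prodr_ge0 => *; exact: exprn_ge0.
  rewrite lt_neqAle addr_ge0 ?exprn_ge0// andbT eq_sym paddr_eq0 ?exprn_ge0//.
  have z1' : `|z| <= 1 by rewrite z1.
  rewrite negb_and expf_eq0 normr_eq0 /= root_zero_poly// mem_cat.
  have -> /= : z \in alpha = false.
    by apply/negP => /alpha_disc; rewrite z1 ltxx.
  have [zt|] := boolP (z \in tau); last by rewrite orbT.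
  rewrite orbF prodf_seq_neq0; apply/allP => s ss /=.
  rewrite expf_neq0// normr_eq0 subr_eq0; apply/eqP => zs.
  exact: (sigma_tau ss zt).
Qed.

(** The same identity with D normalized as a Blaschke denominator: the constant
    c > 0 goes into E = m Z with m = 2 c^(-1/2). *)
Lemma royal_identity : exists m (r : seq C), [/\ 0 < m, size r = n,
  forall b, b \in r -> `|b| < 1 &
  4 *: (blaschke_den r * reciprocal n (blaschke_den r)) - (m *: zero_poly) ^+ 2 =
  m ^+ 2 *: node_poly].
Proof.
have [c [r [c0 sr r1 NZ]]] := spectral_factorization.
exists (2 / sqrtC c), r; split => //; first by rewrite divr_gt0 ?sqrtC_gt0.
have mm : (2 / sqrtC c) ^+ 2 = 4 / c by rewrite expr_div_n sqrtCK -natrX.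
rewrite -sr reciprocal_blaschke_den [blaschke_den r * _]mulrC -prod_mirror_pairE.
have -> : node_poly = c *: (\prod_(b <- r) mirror_pair b) - zero_poly ^+ 2.
  by rewrite -NZ addrK.
by rewrite exprZn mm scalerBr scalerA divfK// gt_eqF.
Qed.

End Data.
End Prescribed.

Theorem theorem1p2 (R : realType) (n k0 k1 : nat)
    (alpha : k0.-tuple R[i]) (tau : k1.-tuple R[i]) (sigma : n.-tuple R[i])
    (n_gt0 : (0 < n)%N)
    (alpha_disc : forall a, a \in alpha -> disc a)
    (tau_circle : forall t, t \in tau -> circle t)
    (k0k1 : (2 * k0 + k1 = n)%N)
    (sigma_cdisc : forall z, z \in sigma -> cdisc z)
    (sigma_tau : forall z t, z \in sigma -> t \in tau -> z <> t) :
  exists h : R[i] -> R[i] * R[i],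
    [/\ rational_Gam_inner h,
        Gam_degree h n,
        zeros_with_mult (fun z => (h z).1) (alpha ++ tau) &
        royal_nodes_with_mult h sigma].
Proof.
have balance : (2 * size alpha + size tau = size sigma)%N by rewrite !size_tuple.
pose Z := zero_poly alpha tau; pose N := node_poly sigma.
have [sZ rZ] := zero_poly_self_reciprocal tau_circle balance.
have [m [r [m_gt0 sr r1 royalE]]] :=
  royal_identity alpha_disc tau_circle sigma_tau balance.
rewrite size_tuple -/Z -/N in sZ rZ sr royalE.
pose E := m *: Z; pose D := blaschke_den r.
have sE : (size E <= (size r).+1)%N by rewrite sr (leq_trans (size_scale_leq _ _)).
have rE : reciprocal (size r) E = E.
  by rewrite sr reciprocalZ rZ conj_Creal// gtr0_real.
have E_le_D z : `|z| = 1 -> `|E.[z]| <= 2 * `|D.[z]|.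
  move=> z1; rewrite -(@ler_pXn2r _ 2) ?nnegrE ?mulr_ge0// -subr_ge0.
  have zn : z ^+ n != 0 by rewrite expf_neq0// circle_neq0.
  (* the royal identity at z, divided by z^n *)
  have -> : (2 * `|D.[z]|) ^+ 2 - `|E.[z]| ^+ 2 =
      m ^+ 2 * \prod_(s <- sigma) `|z - s| ^+ 2.
    have Ez := E_circle sE rE z1.
    have D_z := horner_reciprocal_circle (size_blaschke_den r) z1.
    rewrite sr -/D in Ez D_z.
    apply: (mulfI zn); have := congr1 (horner^~ z) royalE.
    rewrite -/E -/D /= hornerD hornerN !hornerZ hornerM D_z expr2 hornerM.
    have <- : E.[z] = m * Z.[z] by rewrite hornerZ.
    have -> : E.[z] * E.[z] = E.[z] * (z ^+ n * (E.[z])^*) by rewrite -Ez.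
    rewrite horner_prod_mirror_pair_circle// size_tuple exprMn !normCK => e.
    transitivity (m ^+ 2 * (z ^+ n * \prod_(s <- sigma) `|z - s| ^+ 2)).
      by rewrite -e; ring.
    by ring.
  apply: mulr_ge0; first by rewrite exprn_ge0// ltW.
  by apply: prodr_ge0 => *; exact: exprn_ge0.
have D0 := blaschke_den_neq0 r1.
pose h := model r E.
have hED : ED_representation n h E D by rewrite -sr; exact: model_ED.
have hdeg : Gam_degree h n by rewrite -sr; exact: model_degree.
have royal z : `|z| <= 1 -> royal_variety (h z) <-> z \in sigma.
  move=> z1; rewrite -root_node_poly//; have Dz := D0 _ z1.
  have rD : reciprocal n D = blaschke_num r by rewrite -sr reciprocal_blaschke_den.
  have := congr1 (horner^~ z) royalE.
  rewrite -/E -/D rD /= hornerD hornerN !hornerZ hornerM.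
  rewrite horner_exp royal_varietyE -/N => e.
  have -> : (N.[z] == 0) = (4 * (D.[z] * (blaschke_num r).[z]) - E.[z] ^+ 2 == 0).
    by rewrite e mulf_eq0 [m ^+ 2 == 0]gt_eqF ?exprn_gt0.
  rewrite subr_eq0 eq_sym -/D; split => [|/eqP] e'.
    apply/eqP; move/(congr1 (fun x => x * D.[z] ^+ 2)): e' => e'.
    transitivity ((E.[z] / D.[z]) ^+ 2 * D.[z] ^+ 2); first by field.
    by rewrite e'; field.
  by rewrite expr_div_n e'; field.
exists h; split => //.
- exact: model_Gam_inner.
- have Ez z : `|z| <= 1 -> (E.[z] == 0) = (z \in alpha ++ tau).
    by move=> z1; rewrite hornerZ mulf_eq0 gt_eqF//= root_zero_poly.
  have cd z : z \in alpha ++ tau -> `|z| <= 1.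
    by rewrite mem_cat => /orP[/alpha_disc/ltW|/tau_circle ->].
  split => [z|z /cd z1] /=.
    split => [[z1 /eqP]|zs].
      by rewrite mulf_eq0 invr_eq0 (negPf (D0 _ z1)) orbF Ez.
    by split; [exact: cd|apply/eqP; rewrite mulf_eq0 Ez ?zs//; exact: cd].
  have [q qz ZE] := mup_factor z (zero_poly_neq0 alpha tau_circle).
  exists (m *: q), D; split.
  + by rewrite hornerZ mulf_neq0// gt_eqF.
  + exact: D0.
  + move=> w /D0 Dw; rewrite divfK// /E /Z ZE mup_zero_poly//.
    by rewrite !hornerZ hornerM horner_exp hornerXsubC; ring.
- split.
  + have [z z1 zs] := seq_avoid sigma.
    by move=> /(_ z z1)/(royal z z1); rewrite (negPf zs).
  + move=> z; split => [[z1 /(royal z z1)]|zs] //.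
    by split; [exact: sigma_cdisc|apply/royal => //; exact: sigma_cdisc].
  + move=> z /sigma_cdisc z1; exists (m ^+ 2 *: N); split.
      by exists n, E, D; split.
    by rewrite mupZ ?mup_node_poly// gt_eqF ?exprn_gt0.
Qed.
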